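(* Every right-angled Coxeter group $W_\Gamma$ is profinitely rigid relative to the class of Coxeter groups: if $W$ is any Coxeter group (over a finite labelled graph) with the same set of isomorphism classes of finite quotients as $W_\Gamma$ (equivalently $\widehat W\cong\widehat{W_\Gamma}$), then $W\cong W_\Gamma$.
   Context: For a finite simplicial graph $\Gamma=(V,E)$ with edge labelling $m\colon E\to\mathbb{N}_{\ge2}$, $W_\Gamma=\langle V\mid v^2,\ (vw)^{m(\{v,w\})}\text{ for }\{v,w\}\in E\rangle$; it is right-angled if all labels equal $2$. $\widehat{G}$ is the profinite completion. *)

(* Defs.v *)
(* Coxeter groups as finitely presented groups, realised as
   the setoid of words over generators and their formal inverses, modulo the
   congruence generated by free reduction and the Coxeter relators. *)
From mathcomp Require Import all_boot all_fingroup.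
Set Implicit Arguments. Unset Strict Implicit. Unset Printing Implicit Defensive.

Definition simplicial_graph (V : finType) (E : rel V) : Prop :=
  (forall v, ~~ E v v) /\ (forall v w, E v w = E w v).

Definition coxeter_labelling (V : finType) (E : rel V) (m : V -> V -> nat) : Prop :=
  forall v w, E v w -> (2 <= m v w) /\ m v w = m w v.

Definition right_angled (V : finType) (E : rel V) (m : V -> V -> nat) : Prop :=
  forall v w, E v w -> m v w = 2.

(* letters: (v, true) = v, (v, false) = v^{-1} *)
Definition letter (V : finType) := (V * bool)%type.
Definition word (V : finType) := seq (letter V).

Definition gen (V : finType) (v : V) : word V := [:: (v, true)].

Inductive cox_rel (V : finType) (E : rel V) (m : V -> V -> nat) :
  word V -> word V -> Prop :=
| cr_free (v : V) (b : bool) : cox_rel E m [:: (v, b); (v, ~~ b)] [::]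
| cr_sq (v : V) : cox_rel E m (gen v ++ gen v) [::]
| cr_edge (v w : V) : E v w ->
    cox_rel E m (flatten (nseq (m v w) (gen v ++ gen w))) [::].

Inductive wcong (A : Type) (R : seq A -> seq A -> Prop) : seq A -> seq A -> Prop :=
| wc_base u v : R u v -> wcong R u v
| wc_refl u : wcong R u u
| wc_sym u v : wcong R u v -> wcong R v u
| wc_trans u v w : wcong R u v -> wcong R v w -> wcong R u w
| wc_cat u u' v v' : wcong R u u' -> wcong R v v' -> wcong R (u ++ v) (u' ++ v').

Definition cox_eq (V : finType) (E : rel V) (m : V -> V -> nat) :=
  wcong (@cox_rel V E m).

Definition coxeter_iso (V : finType) (E : rel V) (m : V -> V -> nat)
  (V' : finType) (E' : rel V') (m' : V' -> V' -> nat) : Prop :=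
  exists (f : word V -> word V') (g : word V' -> word V),
    [/\ (forall u v, cox_eq E m u v -> cox_eq E' m' (f u) (f v)) /\
        (forall u v, cox_eq E' m' u v -> cox_eq E m (g u) (g v)),
        (forall u v, cox_eq E' m' (f (u ++ v)) (f u ++ f v)),
        (forall u v, cox_eq E m (g (u ++ v)) (g u ++ g v)),
        (forall u, cox_eq E m (g (f u)) u) &
        (forall u, cox_eq E' m' (f (g u)) u)].

Definition coxeter_fin_quotient (V : finType) (E : rel V) (m : V -> V -> nat)
  (gT : finGroupType) (G : {group gT}) : Prop :=
  exists f : word V -> gT,
    [/\ (forall u v, cox_eq E m u v -> f u = f v),
        (forall u v, f (u ++ v) = (f u * f v)%g),
        (forall u, f u \in G) &
        (forall x, x \in G -> exists u, f u = x)].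

(* Main.v *)
(* Representations of a Coxeter group in a finite group are the assignments of
   the generators that satisfy the relations, and two Coxeter groups with the
   same finite quotients have equally many representations in every finite
   group.

   In a 2-group a Coxeter group on V' is seen only through the set U of
   components of its odd edges and, on class-2 quotients, through the graph F
   of edges with label 2 mod 4. The right-angled group of a graph has a class-2
   quotient in which commuting involutions have, modulo commutators, exponent
   vectors over F_2 whose supports together form a clique. A surjection onto
   it gives a matrix of full rank over F_2, and a nonzero term in the expansion
   of a maximal minor is an injection of vertex sets; the injections in the
   two directions make F isomorphic to the graph of the right-angled group.

   Hence the Coxeter group and the right-angled group of F have equally many
   representations. Comparing them in dihedral 2-groups shows that every edge
   between distinct components is an edge of F, so the Coxeter group maps onto
   the right-angled group of F, and then every representation of it factors
   through this map. The reflection representation over a finite field, in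
   which the product of adjacent generators has the order given by the label,
   excludes all labels other than 2. *)
Require Import Defs.
From HB Require Import structures.
From mathcomp Require Import all_boot all_fingroup all_algebra all_solvable all_field.
From mathcomp Require Import ring.
Set Implicit Arguments. Unset Strict Implicit. Unset Printing Implicit Defensive.

Import GRing.Theory.
Local Open Scope group_scope.

(** * Finite quotients as representations given on generators *)

Definition cox_rep (V : finType) (E : rel V) (m : V -> V -> nat)
    (gT : finGroupType) (f : V -> gT) : bool :=
  [forall v, f v * f v == 1] &&
  [forall v, forall w, E v w ==> ((f v * f w) ^+ m v w == 1)].

Definition two_lab (V : finType) (_ _ : V) : nat := 2.

Section Representations.

Variables (V : finType) (E : rel V) (m : V -> V -> nat) (gT : finGroupType).
Implicit Type f : V -> gT.

Lemma cox_repP f :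
  reflect ((forall v, f v * f v = 1) /\
           (forall v w, E v w -> (f v * f w) ^+ m v w = 1)) (cox_rep E m f).
Proof.
apply: (iffP andP) => -[].
  move=> /forallP f2 /forallP fE; split=> [v|v w Evw]; first exact/eqP.
  by have /forallP/(_ w)/implyP/(_ Evw)/eqP := fE v.
move=> f2 fE; split; first by apply/forallP => v; rewrite f2.
apply/forallP=> v; apply/forallP=> w; apply/implyP=> Evw.
by rewrite (fE _ _ Evw).
Qed.

Lemma eq_cox_rep f g : f =1 g -> cox_rep E m f = cox_rep E m g.
Proof.
move=> fg; apply/cox_repP/cox_repP => -[f2 fE].
  by split=> [v|v w Evw]; rewrite -!fg ?f2 ?fE.
by split=> [v|v w Evw]; rewrite !fg ?f2 ?fE.
Qed.

Definition eval_word f (u : word V) : gT :=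
  \prod_(l <- u) (if l.2 then f l.1 else (f l.1)^-1).

Lemma eval_word_cat f u v : eval_word f (u ++ v) = eval_word f u * eval_word f v.
Proof. by rewrite /eval_word big_cat. Qed.

Lemma eval_word_gen f v : eval_word f (gen v) = f v.
Proof. by rewrite /eval_word big_seq1. Qed.

Lemma eval_word_pow f n u : eval_word f (flatten (nseq n u)) = eval_word f u ^+ n.
Proof.
elim: n => [|n IHn]; first by rewrite /eval_word big_nil.
by rewrite /= eval_word_cat IHn expgS.
Qed.

Lemma eval_word_eq f u v : cox_rep E m f -> cox_eq E m u v ->
  eval_word f u = eval_word f v.
Proof.
move=> /cox_repP[f2 fE]; elim=> {u v}; last 1 first.
- by move=> u u' v v' _ IHu _ IHv; rewrite !eval_word_cat IHu IHv.
- move=> u v [{u v}v b|{u v}v|{u v}v w Evw]; rewrite /(eval_word f [::]) big_nil.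
  + rewrite /eval_word big_cons big_seq1 /=.
    by case: b; rewrite /= (mulgV, mulVg).
  + by rewrite eval_word_cat eval_word_gen f2.
  + by rewrite eval_word_pow eval_word_cat !eval_word_gen fE.
- by [].
- by move=> u v _ ->.
- by move=> u v w _ -> _ ->.
Qed.

Lemma cox_rep_fin_quotient f :
  cox_rep E m f -> coxeter_fin_quotient E m <<[set f v | v in V]>>.
Proof.
move=> frep; exists (eval_word f); split.
- by move=> u v; apply: eval_word_eq.
- exact: eval_word_cat.
- move=> u; rewrite /eval_word; apply: group_prod => -[v b] _ /=.
  have fvG : f v \in <<[set f v | v in V]>> by rewrite mem_gen // imset_f.
  by case: b; rewrite ?groupV.
move=> x /gen_prodgP[n [c cG ->]].
have cV i : exists v, c i = f v by have /imsetP[v _ ->] := cG i; exists v.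
have [s defs] := fin_all_exists cV.
exists [seq (s i, true) | i <- index_enum 'I_n].
by rewrite /eval_word big_map; apply: eq_bigr => i _; rewrite defs.
Qed.

Lemma fin_quotient_cox_rep (G : {group gT}) : coxeter_fin_quotient E m G ->
  exists2 f : V -> gT, cox_rep E m f & <<[set f v | v in V]>> = G.
Proof.
case=> F [Fe FM FG Gs].
have F1 : F [::] = 1 by apply: (mulIg (F [::])); rewrite -FM mul1g.
have powF n u : F (flatten (nseq n u)) = F u ^+ n.
  by elim: n => [|n IHn] //=; rewrite FM IHn expgS.
exists (fun v => F (gen v)).
  apply/cox_repP; split=> [v|v w Evw]; rewrite -FM -?powF -F1.
    exact/Fe/wc_base/cr_sq.
  exact/Fe/wc_base/cr_edge.
apply/eqP; rewrite eqEsubset gen_subG; apply/andP; split.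
  by apply/subsetP=> _ /imsetP[v _ ->]; apply: FG.
apply/subsetP=> _ /Gs[u <-].
elim: u => [|[v b] u IHu]; first by rewrite F1 group1.
rewrite -cat1s FM groupM //.
have vG : F (gen v) \in <<[set F (gen v) | v in V]>>.
  by rewrite mem_gen //; apply/imsetP; exists v.
case: b => //; rewrite -(groupV _ (F _)) .
suff -> : (F [:: (v, false)])^-1 = F (gen v) by [].
apply/esym/(mulIg (F [:: (v, false)])); rewrite mulVg -FM -F1.
exact/Fe/wc_base/(cr_free _ _ v true).
Qed.

End Representations.

(** * Counting representations in a finite group *)

Definition reps (V : finType) (E : rel V) m (gT : finGroupType) :=
  [set f : {ffun V -> gT} | cox_rep E m f].

Lemma expg_ffun (I : finType) (gT : finGroupType) (x : {dffun I -> gT}) n i :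
  (x ^+ n) i = x i ^+ n.
Proof.
elim: n => [|n IHn]; first by rewrite !expg0 ffunE.
by rewrite !expgS dffunM IHn.
Qed.

Section CountingRepresentations.

Variables (V1 : finType) (E1 : rel V1) (m1 : V1 -> V1 -> nat).
Variables (V2 : finType) (E2 : rel V2) (m2 : V2 -> V2 -> nat).

(* All representations of the first group in [gT] assemble into one finite
   quotient, inside a power of [gT]; the coordinates of a surjection of the
   second group onto it are pairwise distinct representations. *)
Lemma leq_card_reps (gT : finGroupType) :
    (forall (hT : finGroupType) (H : {group hT}),
       coxeter_fin_quotient E1 m1 H -> coxeter_fin_quotient E2 m2 H) ->
  #|reps E1 m1 gT| <= #|reps E2 m2 gT|.
Proof.
move=> q12; pose I : finType := {f : {ffun V1 -> gT} | f \in reps E1 m1 gT}.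
pose D (v : V1) : {dffun I -> gT} := [ffun i : I => val i v].
have Drep : cox_rep E1 m1 D.
  apply/cox_repP; split=> [v|v w Evw]; apply/ffunP=> i.
    rewrite dffunM !ffunE; case: i => f /=; rewrite inE => /cox_repP[f2 _].
    exact: f2.
  rewrite expg_ffun dffunM !ffunE; case: i => f /=; rewrite inE => /cox_repP[_].
  exact.
have [h hrep genh] := fin_quotient_cox_rep (q12 _ _ (cox_rep_fin_quotient Drep)).
pose k (i : I) : {ffun V2 -> gT} := [ffun v => h v i].
have kinj : injective k.
  move=> i j kij; apply/val_inj/ffunP => v.
  (* The equalizer of the coordinates [i] and [j] is a subgroup; containing every [h w], it contains
     every [D v]. *)
  pose K := [set x : {dffun I -> gT} | x i == x j].
  have Kgrp : group_set K.
    apply/group_setP; split=> [|x y]; rewrite !inE ?ffunE //.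
    by move=> /eqP-> /eqP->.
  have : D v \in Group Kgrp.
    have: D v \in <<[set h v | v in V2]>> by rewrite genh mem_gen ?imset_f.
    apply/subsetP; rewrite gen_subG; apply/subsetP=> _ /imsetP[w _ ->].
    by rewrite inE; move/ffunP/(_ w): kij; rewrite !ffunE => ->.
  by rewrite inE !ffunE => /eqP.
have -> : #|reps E1 m1 gT| = #|I| by rewrite card_sig; apply: eq_card => f; rewrite !inE.
rewrite -(card_imset predT kinj); apply/subset_leq_card/subsetP=> _ /imsetP[i _ ->].
rewrite inE; move/cox_repP: hrep => [h2 hE]; apply/cox_repP.
split=> [v|v w Evw]; rewrite !ffunE.
  by move/ffunP/(_ i): (h2 v); rewrite dffunM ffunE.
by move/ffunP/(_ i): (hE v w Evw); rewrite expg_ffun dffunM ffunE.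
Qed.

End CountingRepresentations.

(** * Reduction of a Coxeter group as seen by 2-groups *)

Section TwoReduction.

Variables (V : finType) (E : rel V) (m : V -> V -> nat).

Definition odd_edge : rel V := [rel v w | E v w && odd (m v w)].

(* In a 2-group, generators joined by an edge with odd label have the same
   image, and generators joined by an edge with label 2 mod 4 commute: [U] is
   the set of components of the odd edges, [F] records the commutations. *)
Record two_reduction (U : finType) (F : rel U) (r : V -> U) (s : U -> V) : Prop :=
  TwoReduction {
    red_simplicial : simplicial_graph F;
    redK : cancel s r;
    red_class : forall v w, (r v == r w) = connect odd_edge v w;
    red_edge : forall u u', F u u' = (u != u') &&
      [exists v, exists w, [&& r v == u, r w == u', E v w & m v w %% 4 == 2]]
  }.

Hypotheses (Esimp : simplicial_graph E) (Elab : coxeter_labelling E m).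

Lemma two_reduction_exists : exists (U : finType) (F : rel U) r s,
  two_reduction F r s.
Proof.
have [Eirr Esym] := Esimp.
have csym : connect_sym odd_edge.
  apply: sym_connect_sym => v w; rewrite /odd_edge /= Esym.
  by case Ewv: (E w v) => //=; have [_ ->] := Elab Ewv.
pose U : finType := {v : V | fingraph.root odd_edge v == v}.
pose r v : U := exist _ (fingraph.root odd_edge v) (roots_root csym v).
pose F (u u' : U) := (u != u') &&
  [exists v, exists w, [&& r v == u, r w == u', E v w & m v w %% 4 == 2]].
exists U, F, r, val; split=> //.
- split=> [u|u u']; rewrite /F; first by rewrite eqxx.
  rewrite eq_sym; congr (_ && _); apply/existsP/existsP => -[v /existsP[w]];
    case/and4P=> rv rw Evw mvw; exists w; apply/existsP; exists v;
    by have [_ mC] := Elab Evw; rewrite rv rw Esym Evw -mC.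
- by move=> u; apply: val_inj; apply/eqP/(valP u).
- move=> v w; rewrite -(root_connect csym) -val_eqE; exact.
Qed.

Variables (U : finType) (F : rel U) (r : V -> U) (s : U -> V).
Hypothesis red : two_reduction F r s.

Lemma red_odd_edge v w : E v w -> odd (m v w) -> r v = r w.
Proof.
by move=> Evw mvw; apply/eqP; rewrite (red_class red); apply: connect1; rewrite /odd_edge /= Evw.
Qed.

(** The product of adjacent generators has order a power of 2 dividing the label: order 1 for an odd
    label, at most 2 for a label 2 mod 4. *)
Lemma cox_rep_two_reduction (gT : finGroupType) (f : V -> gT) :
    2.-group [set: gT] -> cox_rep E m f ->
  (forall v, f v = f (s (r v))) /\ cox_rep F (@two_lab U) (f \o s).
Proof.
move=> gT2 /cox_repP[f2 fE].
have ord2 (x : gT) : exists k, #[x] = (2 ^ k)%N.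
  by have [k ->] := p_natP (mem_p_elt gT2 (in_setT x)); exists k.
have fr v w : r v = r w -> f v = f w.
  move/eqP; rewrite (red_class red) => /connectP[p].
  elim: p v => [v _ -> //|x p IHp v /= /andP[/andP[Evx mvx] px] lw].
  rewrite -(IHp x px lw); have [k fk] := ord2 (f v * f x).
  have /eqP := fE v x Evx; rewrite -order_dvdn fk.
  case: k fk => [fk _|k _ d]; last first.
    by move: (dvdn_trans (dvdn_exp (ltn0Sn k) (dvdnn 2)) d); rewrite dvdn2 mvx.
  have /eqP := fk; rewrite expn0 order_eq1 => /eqP fvx.
  by apply: (mulIg (f x)); rewrite fvx f2.
have fK v : f v = f (s (r v)) by apply: fr; rewrite (redK red).
split=> //; apply/cox_repP; split=> [u|u u' /=]; first exact: f2.
rewrite (red_edge red) => /andP[_ /existsP[v /existsP[w]]].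
case/and4P=> /eqP<- /eqP<- Evw mvw; rewrite -!fK; have [k fk] := ord2 (f v * f w).
have /eqP := fE v w Evw; rewrite -order_dvdn fk => d.
apply/eqP; rewrite -order_dvdn fk /two_lab; case: k d {fk} => [|[|k]] // d.
have : 4 %| m v w by apply: dvdn_trans d; rewrite !expnS mulnA dvdn_mulr.
by rewrite /dvdn (eqP mvw).
Qed.

End TwoReduction.

(** * The class-2 quotient of a right-angled group *)

Section Heisenberg.

Variables (V : finType) (E : rel V).

(* The quotient of class 2 of the right-angled group of [E], extended by the
   central elements: first the exponents modulo 2 of the generators, then one
   central coordinate for each ordered pair of non-adjacent generators. *)
Definition heis (_ : rel V) : Type := ({ffun V -> bool} * {ffun V * V -> bool})%type.

HB.instance Definition _ := Finite.on (heis E).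

Definition nonadj (v w : V) := (v != w) && ~~ E v w.

(** A central extension by a bilinear, hence associative, cocycle. Being indexed by ordered pairs it
    is not symmetric, and its antisymmetrization is the commutator. *)
Definition heis_mul (x y : heis E) : heis E :=
  ([ffun v => x.1 v (+) y.1 v],
   [ffun p => x.2 p (+) y.2 p (+) [&& nonadj p.1 p.2, x.1 p.1 & y.1 p.2]]).

Definition heis_inv (x : heis E) : heis E :=
  (x.1, [ffun p => x.2 p (+) [&& nonadj p.1 p.2, x.1 p.1 & x.1 p.2]]).

Definition heis_one : heis E := ([ffun=> false], [ffun=> false]).

Lemma heisP (x y : heis E) : x.1 =1 y.1 -> x.2 =1 y.2 -> x = y.
Proof. by case: x y => [a c] [b d] /= /ffunP-> /ffunP->. Qed.

Lemma heis_mulA : associative heis_mul.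
Proof.
move=> x y z; apply: heisP => [v|p]; rewrite !ffunE /=; first exact: addbA.
case: (nonadj _ _) => /=; last by rewrite !addbF addbA.
move: (x.1 _) (x.2 _) (y.1 _) (y.1 _) (y.2 _) (z.1 _) (z.2 _).
by do 7 case.
Qed.

Lemma heis_mul1 : left_id heis_one heis_mul.
Proof.
by move=> x; apply: heisP => [v|p]; rewrite !ffunE //= andbF addbF.
Qed.

Lemma heis_mulV : left_inverse heis_one heis_inv heis_mul.
Proof.
move=> x; apply: heisP => [v|p]; rewrite !ffunE /= ?addbb //.
by case: (x.2 _); case: [&& _, _ & _].
Qed.

HB.instance Definition _ := Finite_isGroup.Build (heis E) heis_mulA heis_mul1 heis_mulV.

Lemma heis1E (x y : heis E) v : (x * y).1 v = x.1 v (+) y.1 v.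
Proof. by rewrite ffunE. Qed.

Lemma heis2E (x y : heis E) p :
  (x * y).2 p = x.2 p (+) y.2 p (+) [&& nonadj p.1 p.2, x.1 p.1 & y.1 p.2].
Proof. by rewrite ffunE. Qed.

Lemma heis_2group : 2.-group [set: heis E].
Proof.
by rewrite /pgroup cardsT card_prod !card_ffun card_bool pnatM !pnatX pnat_id.
Qed.

(** Thanks to exponent 4, relations with label divisible by 4 hold automatically. *)
Lemma heis_expg4 (x : heis E) : x ^+ 4 = 1.
Proof.
rewrite (expgM x 2 2) !expgS !expg0 !mulg1.
apply: heisP => [v|p]; first by rewrite heis1E addbb ffunE.
by rewrite heis2E addbb !heis1E !addbb ffunE /= andbF.
Qed.

Definition heis_gen (v : V) : heis E := ([ffun w => w == v], [ffun=> false]).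

Hypothesis Esimp : simplicial_graph E.

Lemma heis_gen_rep : cox_rep E (@two_lab V) heis_gen.
Proof.
have [Eirr Esym] := Esimp.
have g2 v : heis_gen v * heis_gen v = 1.
  apply: heisP => [w|[w w']]; first by rewrite heis1E addbb !ffunE.
  rewrite heis2E /= !ffunE /nonadj; have [->|] := eqVneq w v; last by rewrite andbF.
  by have [->|] := eqVneq w' v; rewrite ?eqxx ?andbF.
apply/cox_repP; split=> // v w Evw; rewrite /two_lab expgS expg1.
suff gC : commute (heis_gen v) (heis_gen w).
  by rewrite {1}gC -mulgA (mulgA (heis_gen v)) g2 mul1g g2.
apply: heisP => [x|[x y]]; first by rewrite !heis1E addbC.
rewrite !heis2E !ffunE /nonadj /=.
have -> : [&& (x != y) && ~~ E x y, x == v & y == w] = false.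
  by apply/negbTE/negP => /and3P[/andP[_ nE] /eqP ex /eqP ey]; case/negP: nE; rewrite ex ey Evw.
by apply/esym/negbTE/negP => /and3P[/andP[_ nE] /eqP ex /eqP ey]; case/negP: nE; rewrite ex ey Esym Evw.
Qed.

(** If [v] and [w] were not adjacent, the coordinate [(v, w)] of [x * x] would give [x.1 w = false],
    and then [x * y] and [y * x] would differ at [(v, w)]. *)
Lemma heis_commuting_involutions (x y : heis E) v w :
  x * x = 1 -> x * y = y * x -> x.1 v -> y.1 w -> v != w -> E v w.
Proof.
have [Eirr Esym] := Esimp.
move=> xx xy xv yw vw; apply/negPn/negP => nE.
have Nvw : nonadj v w by rewrite /nonadj vw.
have := congr1 (fun z : heis E => z.2 (v, w)) xy.
have := congr1 (fun z : heis E => z.2 (v, w)) xx.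
rewrite /= !heis2E ffunE /= Nvw xv yw /= addbb addFb => xw.
by rewrite xw andbF addbF addbT (addbC (y.2 _)); case: (_ (+) _).
Qed.

End Heisenberg.

(** * Matchings of vertex sets from matrices of full rank *)

(** A nonzero maximal minor has a nonzero Leibniz term, whose permutation selects the entries. *)
Lemma row_full_transversal (K : fieldType) p q (A : 'M[K]_(p, q)) :
  row_full A -> exists2 t : 'I_q -> 'I_p, injective t & forall j, A (t j) j != 0%R.
Proof.
move=> Afull; pose t0 := fullrankfun Afull.
have := fullrowsub_unit Afull; rewrite unitmxE unitfE -/t0 => detA.
have /existsP[sg /forallP sgP] : [exists sg : 'S_q, [forall i, A (t0 i) (sg i) != 0%R]].
  apply: contraNT detA; rewrite negb_exists => /forallP no_sg.
  rewrite /determinant big1 // => sg _; apply/eqP; rewrite mulf_eq0.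
  apply/orP; right; have /forallPn[i] := no_sg sg; rewrite negbK => Ai.
  by apply/prodf_eq0; exists i; rewrite ?mxE.
exists (t0 \o sg^-1); first exact: inj_comp (@fullrankfun_inj _ _ _ _ Afull) perm_inj.
by move=> j; have := sgP (sg^-1 j); rewrite permKV.
Qed.

Lemma involutions_commute (gT : finGroupType) (x y : gT) :
  x * x = 1 -> y * y = 1 -> (x * y) ^+ 2 = 1 -> x * y = y * x.
Proof.
move=> x2 y2; rewrite expgS expg1 => xy2; apply: (mulIg (x * y)); rewrite xy2.
by rewrite -mulgA (mulgA x) x2 mul1g y2.
Qed.

(** Exponent vectors are additive, with [bool] as F_2, so those of the [g t] span the whole space. A
    transversal puts [v] in the support of [g (t v)]; adjacency in [A] makes these involutions
    commute. *)
Lemma heis_matching (V : finType) (E : rel V) (T : finType) (A : rel T)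
    (g : T -> heis E) :
    simplicial_graph E -> cox_rep A (@two_lab T) g ->
    (forall v, heis_gen E v \in <<[set g t | t in T]>>) ->
  exists2 t : V -> T, injective t & forall v w, v != w -> A (t v) (t w) -> E v w.
Proof.
move=> Esimp /cox_repP[g2 gA] gen_g.
pose M : 'M[bool]_(#|T|, #|V|) := (\matrix_(i, j) (g (enum_val i)).1 (enum_val j))%R.
pose rw (x : heis E) : 'rV[bool]_#|V| := (\row_j x.1 (enum_val j))%R.
pose K := [set x : heis E | (rw x <= M)%MS].
have Kgrp : group_set K.
  apply/group_setP; split=> [|x y]; rewrite !inE.
    suff -> : rw 1 = 0%R by rewrite sub0mx.
    by apply/rowP => j; rewrite !mxE ffunE.
  move=> xM yM; suff -> : rw (x * y) = (rw x + rw y)%R by rewrite addmx_sub.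
  by apply/rowP => j; rewrite !mxE heis1E.
have Mfull : row_full M.
  rewrite -sub1mx; apply/row_subP => i.
  have : heis_gen E (enum_val i) \in Group Kgrp.
    move: (gen_g (enum_val i)); apply/subsetP; rewrite gen_subG.
    apply/subsetP => _ /imsetP[t _ ->]; rewrite inE.
    suff -> : rw (g t) = row (enum_rank t) M by apply: row_sub.
    by apply/rowP => j; rewrite !mxE enum_rankK.
  rewrite inE; suff -> : rw (heis_gen E (enum_val i)) = row i 1%:M by [].
  by apply/rowP => j; rewrite !mxE ffunE (inj_eq enum_val_inj) eq_sym; case: eqP.
have [t tinj tM] := row_full_transversal Mfull.
exists (fun v => enum_val (t (enum_rank v))).
  by move=> v w /enum_val_inj/tinj/enum_rank_inj.
have tP v : (g (enum_val (t (enum_rank v)))).1 v.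
  by have := tM (enum_rank v); rewrite mxE enum_rankK; case: (_ v).
move=> v w vw At; apply: heis_commuting_involutions (tP v) (tP w) vw => //.
by apply: involutions_commute => //; have := gA _ _ At.
Qed.

(** Cardinality makes both injections bijective. Their inverses preserve edges, so the edge counts
    agree and the inclusion of edge sets is an equality. *)
Lemma graph_iso_of_matchings (V U : finType) (E : rel V) (F : rel U)
    (t : V -> U) (t' : U -> V) :
    simplicial_graph E -> simplicial_graph F -> injective t -> injective t' ->
    (forall v w, v != w -> F (t v) (t w) -> E v w) ->
    (forall u u', u != u' -> E (t' u) (t' u') -> F u u') ->
  bijective t /\ forall v w, E v w = F (t v) (t w).
Proof.
move=> [Eirr _] [Firr _] tinj t'inj tE t'F.
have bij_t : bijective t by apply: inj_card_bij => //; apply: leq_card t'inj.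
have bij_t' : bijective t' by apply: inj_card_bij => //; apply: leq_card tinj.
split=> //; have [t1 tK t1K] := bij_t; have [t1' tK' t1K'] := bij_t'.
pose EE := [set p : V * V | E p.1 p.2]; pose FF := [set p : U * U | F p.1 p.2].
have inj2 : injective (fun p : V * V => (t p.1, t p.2)).
  by move=> [a b] [c d] [/tinj-> /tinj->].
have inj2' : injective (fun p : U * U => (t' p.1, t' p.2)).
  by move=> [a b] [c d] [/t'inj-> /t'inj->].
have sFE : FF \subset [set (t p.1, t p.2) | p in EE].
  apply/subsetP=> -[u u']; rewrite inE /= => Fuu'.
  apply/imsetP; exists (t1 u, t1 u'); last by rewrite /= !t1K.
  rewrite inE /= tE ?t1K //; apply: contraTneq Fuu' => /(can_inj t1K) ->.
  exact: Firr.
have sEF : EE \subset [set (t' p.1, t' p.2) | p in FF].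
  apply/subsetP=> -[v v']; rewrite inE /= => Evv'.
  apply/imsetP; exists (t1' v, t1' v'); last by rewrite /= !t1K'.
  rewrite inE /= t'F ?t1K' //; apply: contraTneq Evv' => /(can_inj t1K') ->.
  exact: Eirr.
have /eqP eqFE : FF == [set (t p.1, t p.2) | p in EE].
  rewrite eqEcard sFE card_imset //.
  by have := subset_leq_card sEF; rewrite card_imset.
move=> v w; have : ((t v, t w) \in FF) = ((v, w) \in EE).
  by rewrite eqFE -[(t v, t w)]/((fun p => (t p.1, t p.2)) (v, w)) mem_imset.
by rewrite !inE.
Qed.

(** * Dihedral 2-groups, and roots of unity in finite fields *)

Lemma dihedral_involutions n : 0 < n -> exists (gT : finGroupType) (x y : gT),
  [/\ 2.-group [set: gT], x * x = 1, y * y = 1 & (x * y) ^+ n != 1].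
Proof.
move=> n0; have [[x y] [cD _ ox _] [oy xy]] :=
  generators_2dihedral (ltn0Sn n.+1 : 1 < n.+2) (isog_refl [set: 'D_(2 ^ n.+2)]%G).
have y2 : y * y = 1 by have := expg_order y; rewrite oy.
(* Two reflections whose product is the rotation [x], of order 2^(n+1) > n. *)
exists ('D_(2 ^ n.+2))%type, y, (y * x); split=> //.
- by rewrite /pgroup cD pnatX pnat_id.
- have -> : y * x * (y * x) = x ^ y * x.
    by rewrite conjgE -[y^-1]mulg1 -y2 mulKg !mulgA.
  by rewrite xy mulVg.
rewrite mulgA y2 mul1g -order_dvdn ox; apply/negP => /(dvdn_leq n0).
by rewrite leqNgt (leq_trans (ltn_expl n (ltnSn 1))) // leq_exp2l.
Qed.

(** For a prime p > n, Euler's theorem makes n divide p^totient(n) - 1, the order of the cyclic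
    group of units of a field with p^totient(n) elements. *)
Lemma finField_prim_root n : 0 < n ->
  exists (K : finFieldType) (z : K), n.-primitive_root%R z.
Proof.
move=> n0; have [p pn pr] := prime_above n.
have cop : coprime p n.
  by rewrite prime_coprime //; apply/negP => /(dvdn_leq n0); rewrite leqNgt pn.
have tn0 : 0 < totient n by rewrite totient_gt0.
have [K _ cK] := pPrimePowerField pr tn0.
have dvn : n %| #|K|.-1.
  rewrite cK -subn1 -eqn_mod_dvd ?expn_gt0 ?prime_gt0 //.
  exact/eqP/Euler_exp_totient.
have K1 := finNzRing_gt1 K; have K0 := ltnW K1.
pose rs := enum (predC1 (0 : K)%R).
have : has (#|K|.-1).-primitive_root%R rs.
  apply: has_prim_root; rewrite ?enum_uniq //; first by rewrite -ltnS prednK.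
    apply/allP => x; rewrite mem_enum => x0; apply/unity_rootP.
    by apply: (mulfI x0); rewrite -exprS prednK ?expf_card ?mulr1.
  by rewrite -cardE cardC1.
case/hasP=> z _ zprim; exists K, (z ^+ (#|K|.-1 %/ n))%R.
exact: dvdn_prim_root.
Qed.

(** * The reflection representation over a finite field *)

Section Reflections.

Local Open Scope ring_scope.

Variables (V : finType) (E : rel V) (m : V -> V -> nat).
Variables (K : finFieldType) (eta : V -> V -> K).

(** For [eta v w] of order 2m this is the analogue of 2 cos(pi/m) in the Tits representation.
    Without an edge no relation constrains the coefficient. *)
Definition refl_coef v w : K := if E v w then eta v w + (eta v w)^-1 else 0.

Definition reflect_fun (v : V) (x : {ffun V -> K}) : {ffun V -> K} :=
  [ffun w => if w == v then \sum_(u | u != v) refl_coef v u * x u - x v else x w].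

Lemma reflect_funK v : involutive (reflect_fun v).
Proof.
move=> x; apply/ffunP => w; rewrite ffunE; case: eqP => [->|/eqP nwv].
  rewrite [reflect_fun v x v]ffunE eqxx.
  rewrite (eq_bigr (fun u => refl_coef v u * x u)) => [|u /negbTE uv].
    by rewrite subKr.
  by rewrite ffunE uv.
by rewrite ffunE (negbTE nwv).
Qed.

Definition reflect_perm v : {perm {ffun V -> K}} := perm (inv_inj (reflect_funK v)).

Hypotheses (Esimp : simplicial_graph E)
  (etaC : forall v w, E v w -> eta v w = eta w v)
  (eta0 : forall v w, E v w -> eta v w != 0)
  (eta_ord : forall v w, E v w -> eta v w ^+ (2 * m v w) = 1)
  (eta2 : forall v w, E v w -> eta v w ^+ 2 != 1).

Lemma eta_subV v w : E v w -> eta v w - (eta v w)^-1 != 0.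
Proof.
move=> Evw; apply: contraNneq (eta2 Evw) => /subr0_eq h; apply/eqP.
by rewrite expr2 {2}h mulfV ?eta0.
Qed.

Lemma refl_coef_edge v w : E v w ->
  refl_coef v w = eta v w + (eta v w)^-1 /\ refl_coef w v = eta v w + (eta v w)^-1.
Proof.
move=> Evw; have [_ Esym] := Esimp.
by rewrite /refl_coef (Esym w v) Evw (etaC Evw).
Qed.

Lemma reflect_funE v w (y : {ffun V -> K}) : v != w ->
  reflect_fun v y v =
    refl_coef v w * y w + \sum_(u | (u != v) && (u != w)) refl_coef v u * y u - y v.
Proof. by move=> vw; rewrite ffunE eqxx (bigD1 w) //= eq_sym. Qed.

Lemma reflect_fun_out v u (y : {ffun V -> K}) : u != v -> reflect_fun v y u = y u.
Proof. by move=> uv; rewrite ffunE (negbTE uv). Qed.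

(* [y v - eta * y w] and [y v - eta^-1 * y w], corrected by constants that
   depend on the other coordinates only, are eigenvectors of the product of
   the reflections in [v] and [w], with eigenvalues [eta ^+ 2] and its
   inverse. *)
Lemma reflect_perm_pow v w (x : {ffun V -> K}) : E v w ->
  exists A B : K, ((forall u, u != v -> u != w -> x u = 0) -> A = 0 /\ B = 0) /\
  forall k (y := ((reflect_perm v * reflect_perm w) ^+ k)%g x),
  [/\ forall u, u != v -> u != w -> y u = x u,
      (y v - A) - eta v w * (y w - B) =
        eta v w ^+ (2 * k) * ((x v - A) - eta v w * (x w - B)) &
      (y v - A) - (eta v w)^-1 * (y w - B) =
        (eta v w)^-1 ^+ (2 * k) * ((x v - A) - (eta v w)^-1 * (x w - B))].
Proof.
move=> Evw; have [Eirr Esym] := Esimp.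
have nvw : v != w by apply: contraTneq Evw => ->.
have nwv : w != v by rewrite eq_sym.
have [cvw cwv] := refl_coef_edge Evw.
have h0 := eta0 Evw; have e0 := eta_subV Evw.
set h := eta v w in cvw cwv h0 e0 *.
(* In the coordinates [v] and [w], the pair [(A, B)] is the common fixed point of both reflections:
   it solves [eA] and [eB], a system of determinant -(h - h^-1)^2. *)
pose al := \sum_(u | (u != v) && (u != w)) refl_coef v u * x u.
pose be := \sum_(u | (u != w) && (u != v)) refl_coef w u * x u.
pose A := - (2 * al + (h + h^-1) * be) / (h - h^-1) ^+ 2.
pose B := - (2 * be + (h + h^-1) * al) / (h - h^-1) ^+ 2.
have e1 : h * h - 1 != 0.
  apply: contraNneq e0 => e; have -> : h - h^-1 = (h * h - 1) / h by field.
  by rewrite e mul0r.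
have eA : al = 2 * A - (h + h^-1) * B by rewrite /A /B; field; rewrite h0 e1.
have eB : be = 2 * B - (h + h^-1) * A by rewrite /A /B; field; rewrite h0 e1.
exists A, B; split.
  move=> x0; suff [a0 b0] : al = 0 /\ be = 0.
    by rewrite /A /B a0 b0 !mulr0 addr0 oppr0 mul0r.
  split; apply: big1 => u /andP[u1 u2]; rewrite x0 ?mulr0 //.
elim=> [|k [IHx IH1 IH2]] /=.
  by rewrite expg0 perm1 muln0 !expr0 !mul1r.
rewrite expgSr permM; set y := fun_of_perm _ x in IHx IH1 IH2 *.
rewrite permM !permE; set z := reflect_fun v y; set t := reflect_fun w z.
have tu u : u != v -> u != w -> t u = x u.
  by move=> uv uw; rewrite !reflect_fun_out // IHx.
have zw : z w = y w by rewrite reflect_fun_out.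
have tv : t v = z v by rewrite reflect_fun_out.
have zv : z v = (h + h^-1) * y w + al - y v.
  rewrite /z (reflect_funE _ nvw) cvw; congr (_ + _ - _).
  by apply: eq_bigr => u /andP[uv uw]; rewrite IHx.
have tw : t w = (h + h^-1) * z v + be - y w.
  rewrite /t (reflect_funE _ nwv) cwv zw; congr (_ + _ - _).
  by apply: eq_bigr => u /andP[uw uv]; rewrite reflect_fun_out // IHx.
split=> //; rewrite mulnS exprD -mulrA -?IH1 -?IH2 tv tw zv eA eB; field.
all: exact: h0.
Qed.

Lemma reflect_perm_rep : cox_rep E m reflect_perm.
Proof.
apply/cox_repP; split=> [v|v w Evw].
  by apply/permP => x; rewrite permM perm1 !permE reflect_funK.
apply/permP => x; rewrite perm1; have [A [B [_ /(_ (m v w))]]] := reflect_perm_pow x Evw.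
rewrite exprVn eta_ord // invr1 !mul1r; set y := fun_of_perm _ x => -[yu y1 y2].
(* Both eigenvector coordinates are unchanged; their difference is a nonzero multiple of
   [y w - B]. *)
have yw : y w = x w.
  apply: (addIr (- B)); apply: (mulfI (eta_subV Evw)).
  have dE (a b c d : K) : (a - b) * d = (c - b * d) - (c - a * d) by ring.
  by rewrite (dE _ _ (y v - A)) (dE _ _ (x v - A)) y1 y2.
have yv : y v = x v by move: y1; rewrite yw => /addIr/addIr.
apply/ffunP => u; have [->|uv] := eqVneq u v; first exact: yv.
by have [->|uw] := eqVneq u w; [exact: yw | exact: yu].
Qed.

Lemma reflect_perm_order v w : E v w ->
  ((reflect_perm v * reflect_perm w) ^+ 2)%g = 1%g -> eta v w ^+ 4 = 1.
Proof.
(* For the basis vector at [v], [A] and [B] vanish and the first eigenvector equation at exponent 2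
   reads [1 = eta v w ^+ 4]. *)
move=> Evw p2; pose x : {ffun V -> K} := [ffun u => (u == v)%:R].
have nwv : w == v = false.
  by apply: contraTF Evw => /eqP->; have [+ _] := Esimp; apply.
have [A [B [AB /(_ 2%N)]]] := reflect_perm_pow x Evw.
case: AB => [u uv _|-> ->]; first by rewrite ffunE (negbTE uv).
by case=> _ + _; rewrite p2 perm1 !ffunE eqxx nwv !subr0 mulr0 subr0 mulr1.
Qed.

End Reflections.

(** With [eta v w] of order [2 * m v w], a trivial square forces [2 * m v w] to divide 4. *)
Lemma cox_rep_edge_order (V : finType) (E : rel V) (m : V -> V -> nat) :
    simplicial_graph E -> coxeter_labelling E m ->
  exists (gT : finGroupType) (f : V -> gT), cox_rep E m f /\
    forall v w, E v w -> (f v * f w) ^+ 2 = 1 -> m v w = 2.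
Proof.
move=> Esimp Elab.
(* A common multiple of all the orders [2 * m v w], so that one root of unity serves every edge. *)
pose M := (2 * \prod_(p : V * V | E p.1 p.2) m p.1 p.2)%N.
have M0 : 0 < M.
  rewrite muln_gt0 /=; apply: prodn_cond_gt0 => p Ep.
  by have [/ltnW] := Elab _ _ Ep.
have [K [z zprim]] := finField_prim_root M0.
pose eta v w := (z ^+ (M %/ (2 * m v w)))%R.
have eta_prim v w : E v w -> (2 * m v w).-primitive_root%R (eta v w).
  move=> Evw; apply: dvdn_prim_root => //; apply: dvdn_mul => //.
  by rewrite (bigD1 (v, w)) //= dvdn_mulr.
exists {perm {ffun V -> K}}, (reflect_perm E eta).
have etaC v w : E v w -> eta v w = eta w v.
  by move=> Evw; rewrite /eta; have [_ ->] := Elab _ _ Evw.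
have eta0 v w : E v w -> eta v w != 0%R.
  move=> Evw; apply/negP => /eqP h.
  have := prim_expr_order (eta_prim v w Evw); rewrite h expr0n muln_eq0 /=.
  have [m2 _] := Elab _ _ Evw; rewrite (gtn_eqF (ltnW m2)) => /eqP.
  by rewrite eq_sym oner_eq0.
have eta_ord v w : E v w -> (eta v w ^+ (2 * m v w) = 1)%R.
  by move=> Evw; apply/prim_expr_order/eta_prim.
have eta2 v w : E v w -> (eta v w ^+ 2 != 1)%R.
  move=> Evw; rewrite -(prim_order_dvd (eta_prim v w Evw)).
  have [m2 _] := Elab _ _ Evw.
  by apply/negP => /dvdn_leq => /(_ isT); case: (m v w) m2 => [|[|k]]; rewrite ?mulnS.
split=> [|v w Evw p2]; first exact: reflect_perm_rep.
have := reflect_perm_order Esimp etaC eta0 eta2 Evw p2.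
move/eqP; rewrite -(prim_order_dvd (eta_prim v w Evw)) => /dvdn_leq => /(_ isT).
have [m2 _] := Elab _ _ Evw.
by case: (m v w) m2 => [|[|[|k]]]; rewrite ?mulnS.
Qed.

(** * Comparing representations along a map of generators *)

Lemma eq_cox_rep_label (V : finType) (E : rel V) m1 m2 (gT : finGroupType)
    (f : V -> gT) :
  (forall v w, E v w -> m1 v w = m2 v w) -> cox_rep E m1 f = cox_rep E m2 f.
Proof.
move=> m12; apply/cox_repP/cox_repP => -[f2 fE]; split=> // v w Evw.
  by rewrite -m12 ?fE.
by rewrite m12 ?fE.
Qed.

Section Pullback.

Variables (V1 : finType) (E1 : rel V1) (m1 : V1 -> V1 -> nat).
Variables (V2 : finType) (E2 : rel V2) (m2 : V2 -> V2 -> nat).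
Variables (b : V2 -> V1) (c : V1 -> V2) (gT : finGroupType).
Hypothesis (cK : cancel c b).
Hypothesis pull : forall g : V1 -> gT, cox_rep E1 m1 g -> cox_rep E2 m2 (g \o b).

Let pb (g : {ffun V1 -> gT}) : {ffun V2 -> gT} := [ffun v => g (b v)].

Let pb_inj : injective pb.
Proof.
move=> g h /ffunP gh; apply/ffunP => v.
by have := gh (c v); rewrite !ffunE cK.
Qed.

Let pb_reps : pb @: reps E1 m1 gT \subset reps E2 m2 gT.
Proof.
apply/subsetP => _ /imsetP[g + ->]; rewrite !inE => /pull.
by rewrite (@eq_cox_rep _ _ _ _ (g \o b) (pb g)) // => v; rewrite ffunE.
Qed.

Lemma leq_card_reps_pullback : #|reps E1 m1 gT| <= #|reps E2 m2 gT|.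
Proof. by rewrite -(card_imset _ pb_inj) subset_leq_card. Qed.

(** Precomposition with the surjection [b] is injective on representations, so the reverse
    inequality of counts makes it bijective. *)
Lemma cox_rep_pullback (f : V2 -> gT) :
    #|reps E2 m2 gT| <= #|reps E1 m1 gT| -> cox_rep E2 m2 f ->
  exists2 g : V1 -> gT, cox_rep E1 m1 g & f =1 g \o b.
Proof.
move=> le21 frep.
have /eqP eq_im : pb @: reps E1 m1 gT == reps E2 m2 gT.
  by rewrite eqEcard pb_reps card_imset.
have : finfun f \in reps E2 m2 gT.
  by rewrite inE (@eq_cox_rep _ _ _ _ _ f) // => v; rewrite ffunE.
rewrite -eq_im => /imsetP[g]; rewrite inE => grep /ffunP fg; exists g => // v.
by have := fg v; rewrite !ffunE.
Qed.

End Pullback.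

(** * Lifting representations from the reduction *)

Section ReductionLift.

Variables (V : finType) (E : rel V) (m : V -> V -> nat).
Variables (U : finType) (F : rel U) (r : V -> U) (s : U -> V).
Hypotheses (Elab : coxeter_labelling E m) (red : two_reduction E m F r s).

(** Labels between distinct classes are even, and those 2 mod 4 give edges of [F]; only multiples of
    4 need an assumption. *)
Lemma cox_rep_lift (gT : finGroupType) (g : U -> gT) :
    cox_rep F (@two_lab U) g ->
    (forall v w, E v w -> r v != r w -> 4 %| m v w -> (g (r v) * g (r w)) ^+ m v w = 1) ->
  cox_rep E m (g \o r).
Proof.
move=> /cox_repP[g2 gF] g4; apply/cox_repP; split=> [v|v w Evw] /=; first exact: g2.
have [<-|rvw] := eqVneq (r v) (r w); first by rewrite g2 expg1n.
have [/g4->//|m4] := boolP (4 %| m v w).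
have m2 : 2 %| m v w.
  by rewrite dvdn2; apply: contraNN rvw => mo; rewrite (red_odd_edge red Evw).
have Fvw : F (r v) (r w).
  rewrite (red_edge red) rvw; apply/existsP; exists v; apply/existsP; exists w.
  have m42 : (m v w %% 4) %% 2 = 0 by rewrite modn_dvdm //; apply/eqP.
  rewrite !eqxx Evw /=; move: m4 (ltn_pmod (m v w) (isT : 0 < 4)) m42.
  by rewrite /dvdn; case: (m v w %% 4) => [|[|[|[|]]]].
have [k ->] := dvdnP m2; have := gF _ _ Fvw; rewrite /two_lab => g1.
by rewrite mulnC expgM g1 expg1n.
Qed.

Hypothesis leq_reps : forall gT : finGroupType,
  #|reps F (@two_lab U) gT| <= #|reps E m gT|.

(** In a 2-group, restriction along [s] embeds the representations of [E] in those of [F]; by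
    counting it is onto, so [g] is a restriction. *)
Lemma cox_rep_lift_2group (gT : finGroupType) (g : U -> gT) :
  2.-group [set: gT] -> cox_rep F (@two_lab U) g -> cox_rep E m (g \o r).
Proof.
move=> gT2 grep; pose rs (f : {ffun V -> gT}) : {ffun U -> gT} := [ffun u => f (s u)].
have rs_inj : {in reps E m gT &, injective rs}.
  move=> f h; rewrite !inE => /(cox_rep_two_reduction red gT2)[fK _].
  move=> /(cox_rep_two_reduction red gT2)[hK _] /ffunP fh; apply/ffunP => v.
  by have := fh (r v); rewrite !ffunE -fK -hK.
have /eqP rsE : rs @: reps E m gT == reps F (@two_lab U) gT.
  rewrite eqEcard card_in_imset // leq_reps andbT.
  apply/subsetP => _ /imsetP[f + ->]; rewrite !inE.
  move=> /(cox_rep_two_reduction red gT2)[_].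
  by rewrite (@eq_cox_rep _ _ _ _ (f \o s) (rs f)) // => u; rewrite ffunE.
have : finfun g \in reps F (@two_lab U) gT.
  by rewrite inE (@eq_cox_rep _ _ _ _ _ g) // => u; rewrite ffunE.
rewrite -rsE => /imsetP[f]; rewrite inE => frep /ffunP gf.
have [fK _] := cox_rep_two_reduction red gT2 frep.
rewrite (@eq_cox_rep _ _ _ _ _ f) // => v /=.
by have := gf (r v); rewrite !ffunE -fK.
Qed.

(* Non-adjacent classes generate an infinite dihedral group in the
   right-angled group of [F], whose 2-quotients have arbitrarily large order. *)
Lemma red_edge_of_edge v w : E v w -> r v != r w -> F (r v) (r w).
Proof.
move=> Evw rvw; apply/negPn/negP => nF; have [Firr Fsym] := red_simplicial red.
have [m2 _] := Elab Evw.
have [gT [x [y [gT2 x2 y2]]]] := dihedral_involutions (ltnW m2).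
pose g u := if u == r v then x else if u == r w then y else 1.
have grep : cox_rep F (@two_lab U) g.
  have g2 u : g u * g u = 1 by rewrite /g; do 2 case: ifP => // _; rewrite mulg1.
  have sq u : (g u) ^+ 2 = 1 by rewrite expgS expg1.
  apply/cox_repP; split=> // u u' Fuu'; rewrite /two_lab.
  have [gu|gu] := eqVneq (g u) 1; first by rewrite gu mul1g.
  have [gu'|gu'] := eqVneq (g u') 1; first by rewrite gu' mulg1.
  have gE t : g t != 1 -> t = r v \/ t = r w.
    rewrite /g; have [->|_] := eqVneq t (r v); first by left.
    by have [->|_] := eqVneq t (r w); [right | rewrite eqxx].
  have [tu|tu] := gE u gu; have [tu'|tu'] := gE u' gu'; move: Fuu'; rewrite tu tu'.
  - by rewrite (negbTE (Firr _)).
  - by rewrite (negbTE nF).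
  - by rewrite Fsym (negbTE nF).
  - by rewrite (negbTE (Firr _)).
have /cox_repP[_ /(_ v w Evw)] := cox_rep_lift_2group gT2 grep.
by rewrite /= /g eqxx eq_sym (negbTE rvw) eqxx => ->; rewrite eqxx.
Qed.

Hypothesis Esimp : simplicial_graph E.
Hypothesis geq_reps : forall gT : finGroupType,
  #|reps E m gT| <= #|reps F (@two_lab U) gT|.

Lemma right_angled_of_reduction : right_angled E m.
Proof.
have [gT [f [frep fE]]] := cox_rep_edge_order Esimp Elab.
(* Edges between distinct classes now lie in [F], which settles the labels divisible by 4. *)
have lift (g : U -> gT) : cox_rep F (@two_lab U) g -> cox_rep E m (g \o r).
  case/cox_repP=> g2 gF; apply: cox_rep_lift => [|v w Evw rvw]; first exact/cox_repP.
  have := gF _ _ (red_edge_of_edge Evw rvw); rewrite /two_lab => g1 m4.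
  have /dvdnP[k ->] : 2 %| m v w by apply: dvdn_trans m4.
  by rewrite mulnC expgM g1 expg1n.
(* The representation detecting labels factors through [r], where every edge product squares to
   1. *)
have [g grep fg] := cox_rep_pullback (redK red) lift (geq_reps gT) frep.
move=> v w Evw; apply: fE => //; rewrite !fg /=.
have /cox_repP[g2 gF] := grep.
have [<-|rvw] := eqVneq (r v) (r w); first by rewrite g2 expg1n.
exact/gF/red_edge_of_edge.
Qed.

Lemma reduction_graph_iso : injective r /\ forall v w, E v w = F (r v) (r w).
Proof.
have mE := right_angled_of_reduction; have [Eirr Esym] := Esimp.
have rinj : injective r.
  (* With all labels 2 there are no odd edges, so the connecting path is empty. *)
  move=> v w /eqP; rewrite (red_class red) => /connectP[[|x p] /=]; first by [].
  by rewrite /odd_edge /= => /andP[/andP[Evx]]; rewrite mE.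
split=> // v w; apply/idP/idP => [Evw|].
  apply: red_edge_of_edge => //; apply: contraTneq Evw => /rinj->; exact: Eirr.
rewrite (red_edge red) => /andP[_ /existsP[x /existsP[y]]].
by case/and4P=> /eqP/rinj-> /eqP/rinj->.
Qed.

End ReductionLift.

(** * From graph isomorphism to group isomorphism, and rigidity *)

Lemma map_cox_eq (V1 V2 : finType) (E1 : rel V1) (E2 : rel V2) m1 m2 (b : V1 -> V2)
    (mb := map (fun l : letter V1 => (b l.1, l.2) : letter V2)) :
    (forall v w, E1 v w -> E2 (b v) (b w) /\ m2 (b v) (b w) = m1 v w) ->
  forall u v, cox_eq E1 m1 u v -> cox_eq E2 m2 (mb u) (mb v).
Proof.
move=> bE u v; elim=> {u v}.
- move=> u v [x a|x|x y Exy]; rewrite /mb /=; apply: wc_base.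
  + exact: cr_free.
  + exact: cr_sq.
  have [Ebxy mbxy] := bE _ _ Exy; rewrite map_flatten map_nseq -mbxy.
  exact: cr_edge.
- by move=> u; apply: wc_refl.
- by move=> u v _; apply: wc_sym.
- by move=> u v w _ IHu _; apply: wc_trans.
- by move=> u u' v v' _ IHu _ IHv; rewrite /mb !map_cat; apply: wc_cat.
Qed.

Lemma coxeter_iso_of_graph_iso (V1 V2 : finType) (E1 : rel V1) (E2 : rel V2) m1 m2
    (b : V1 -> V2) :
    bijective b -> (forall v w, E1 v w = E2 (b v) (b w)) ->
    (forall v w, E1 v w -> m2 (b v) (b w) = m1 v w) ->
  coxeter_iso E1 m1 E2 m2.
Proof.
move=> [c bK cK] bE bm.
exists (map (fun l => (b l.1, l.2))), (map (fun l => (c l.1, l.2))); split.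
- split; apply: map_cox_eq => v w Evw; first by rewrite -bE bm.
  by rewrite bE !cK -bm ?cK // bE !cK.
- by move=> u v; rewrite map_cat; apply: wc_refl.
- by move=> u v; rewrite map_cat; apply: wc_refl.
- move=> u; rewrite -map_comp map_id_in; first exact: wc_refl.
  by case=> v a _ /=; rewrite bK.
- move=> u; rewrite -map_comp map_id_in; first exact: wc_refl.
  by case=> v a _ /=; rewrite cK.
Qed.

Theorem theorem3p8
  (V : finType) (E : rel V) (m : V -> V -> nat)
  (V' : finType) (E' : rel V') (m' : V' -> V' -> nat) :
  simplicial_graph E -> coxeter_labelling E m -> right_angled E m ->
  simplicial_graph E' -> coxeter_labelling E' m' ->
  (forall (gT : finGroupType) (G : {group gT}),
      coxeter_fin_quotient E' m' G <-> coxeter_fin_quotient E m G) ->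
  coxeter_iso E' m' E m.
Proof.
move=> Esimp Elab Era E'simp E'lab Q.
have repE (gT : finGroupType) (f : V -> gT) :
    cox_rep E m f = cox_rep E (@two_lab V) f by apply: eq_cox_rep_label.
have [U [F [r [s red]]]] := two_reduction_exists E'simp E'lab.
have Fsimp := red_simplicial red.
have [t tinj tE] : exists2 t : V -> U, injective t &
    forall v w, v != w -> F (t v) (t w) -> E v w.
  (* The class-2 quotient for [E] is a quotient of the group of [E'], and as a 2-group it sees only
     [F]. *)
  have hrep : cox_rep E m (heis_gen E) by rewrite repE; apply: heis_gen_rep.
  have [f frep fgen] := fin_quotient_cox_rep ((Q _ _).2 (cox_rep_fin_quotient hrep)).
  have [fK fsrep] := cox_rep_two_reduction red (heis_2group E) frep.
  apply: heis_matching Esimp fsrep _ => v.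
  have : heis_gen E v \in <<[set f v | v in V']>> by rewrite fgen mem_gen ?imset_f.
  apply/subsetP/genS/subsetP => _ /imsetP[x _ ->].
  by apply/imsetP; exists (r x); rewrite //= -fK.
have [t' t'inj t'F] : exists2 t' : U -> V, injective t' &
    forall u u', u != u' -> E (t' u) (t' u') -> F u u'.
  (* Conversely the class-2 quotient for [F] is a quotient of the group of [E'], hence of that of
     [E]. *)
  have hrep : cox_rep E' m' (heis_gen F \o r).
    apply: (cox_rep_lift red) => [|v w _ _ /dvdnP[k ->]]; first exact: heis_gen_rep.
    by rewrite mulnC expgM heis_expg4 expg1n.
  have [f frep fgen] := fin_quotient_cox_rep ((Q _ _).1 (cox_rep_fin_quotient hrep)).
  rewrite repE in frep; apply: heis_matching Fsimp frep _ => u.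
  by rewrite fgen mem_gen //; apply/imsetP; exists (s u); rewrite //= (redK red).
have [[t1 tK t1K] EF] := graph_iso_of_matchings Esimp Fsimp tinj t'inj tE t'F.
(* The isomorphism of [E] with [F] transports the counts for [E'] to [F], as the lifting argument
   requires. *)
have card_EF (gT : finGroupType) : #|reps F (@two_lab U) gT| = #|reps E m gT|.
  apply/eqP; rewrite eqn_leq; apply/andP; split.
    apply: (leq_card_reps_pullback t1K) => g /cox_repP[g2 gF]; rewrite repE.
    by apply/cox_repP; split=> [v|v w]; rewrite /= ?g2 // EF => /gF.
  apply: (leq_card_reps_pullback tK) => g; rewrite repE => /cox_repP[g2 gE].
  apply/cox_repP; split=> [v|u u' Fuu'] /=; first exact: g2.
  by have := gE (t1 u) (t1 u'); rewrite EF !t1K => ->.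
have card_E'E (gT : finGroupType) : #|reps E' m' gT| = #|reps E m gT|.
  by apply/eqP; rewrite eqn_leq; apply/andP; split; apply: leq_card_reps => hT H;
    case: (Q hT H).
have leFE' gT : #|reps F (@two_lab U) gT| <= #|reps E' m' gT| by rewrite card_EF card_E'E.
have geFE' gT : #|reps E' m' gT| <= #|reps F (@two_lab U) gT| by rewrite card_EF card_E'E.
have E'ra := right_angled_of_reduction E'lab red leFE' E'simp geFE'.
have [rinj E'F] := reduction_graph_iso E'lab red leFE' E'simp geFE'.
apply: (coxeter_iso_of_graph_iso (b := t1 \o r)).
- apply: bij_comp; first by exists t.
  by exists s; [move=> v; apply: rinj; rewrite (redK red) | exact: redK red].
- by move=> v w; rewrite E'F EF /= !t1K.
- move=> v w E'vw; rewrite E'ra // Era // EF /= !t1K -E'F //.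
Qed.
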